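(* Let $S$ be the curve $(2x+y)(2x-y)(y+x^2)(y-x^2)=0$. Its local braid monodromy at $(0,0)$ is: the two points $y=1$ and $y=-1$ of the fiber over $x=1$ do two counterclockwise full-twists, and the two other points $y=2$ and $y=-2$ do a counterclockwise full-twist around them. That is, it is the braid induced by the motion in which first $\pm1$ rotate about $0$ by the angle $4\pi$ counterclockwise with $\pm2$ fixed, and then the points $\pm2$ simultaneously make one full counterclockwise revolution along the circle $|y|=2$ (as $\pm2e^{2\pi i t}$) with $\pm1$ fixed.
   Context: Let $E=\{x\in\mathbb{C}:|x|\le 1\}$, $D=\{y\in\mathbb{C}:|y|\le 4\}$, and regard $S$ as a curve in $E\times D$. The projection of $S$ to $E$ has fibers of constant cardinality $n=4$ except over $x=0$. Let $K\subset D$ be the set of $y$-coordinates of the points of $S$ over $x=1$, and let $u_0=-4i$. A motion of $K$ in $D$ consists of $n$ continuous functions $m_i:[0,1]\to D$ with $m_i(t)\ne m_j(t)$ for all $t$ and $i\neq j$, and $\{m_i(0)\}=\{m_i(1)\}=K$. It is realized by a continuous family of diffeomorphisms $D_t$ of $D$, $D_0=\mathrm{Id}$, equal to the identity on $\partial D$, with $D_t(m_i(0))=m_i(t)$; the braid induced by the motion is the class of $D_1$ in the braid group $B_n[D,K]$, the group of diffeomorphisms of $D$ preserving $K$ and equal to the identity on $\partial D$, two being identified if they induce the same automorphism of $\pi_1(D-K,u_0)$. The local braid monodromy of $S$ at $(0,0)$ is the braid induced by the motion formed by the points of $S$ over $x=e^{2\pi i t}$, $0\le t\le 1$. *)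

(* Defs.v *)
From Stdlib Require Import Reals Lra.
From Stdlib Require Import FunctionalExtensionality PropExtensionality.
From Coquelicot Require Export Coquelicot.
Open Scope R_scope.

Definition unit_interval (t : R) : Prop := 0 <= t <= 1.

Definition E (x : C) : Prop := Cmod x <= 1.

Definition D (y : C) : Prop := Cmod y <= 4.

Definition u0 : C := (- RtoC 4 * Ci)%C.

(** Only the values of [path] on [0, 1] matter. *)
Record loop (X : C -> Prop) (u : C) := Loop {
  path :> R -> C;
  path_cont : continuous_on unit_interval path;
  path_in : forall s, unit_interval s -> X (path s);
  path_0 : path 0 = u;
  path_1 : path 1 = u
}.

Definition homotopic {X : C -> Prop} {u : C} (g g' : loop X u) : Prop :=
  exists H : R * R -> C,
    continuous_on (fun p : R * R => unit_interval (fst p) /\ unit_interval (snd p)) H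
    /\ (forall t s, unit_interval t -> unit_interval s -> X (H (t, s)))
    /\ (forall s, unit_interval s -> H (0, s) = g s)
    /\ (forall s, unit_interval s -> H (1, s) = g' s)
    /\ (forall t, unit_interval t -> H (t, 0) = u /\ H (t, 1) = u).

Lemma homotopic_refl X u (g : loop X u) : homotopic g g.
Proof.
exists (fun p => g (snd p)); repeat split; simpl; trivial.
- intros [t s] [_ hs]; simpl in hs.
  apply (filterlim_comp _ _ _ (fun p : R * R => snd p) (path _ _ g) _
           (within unit_interval (locally s))).
  + intros P [e he]; exists e; intros [t' s'] [_ hb] [_ hs'].
    exact (he s' hb hs').
  + now apply path_cont.
- intros t s _ hs; now apply path_in.
- apply path_0.
- apply path_1.
Qed.

Definition clamp (t : R) : R := Rmax 0 (Rmin 1 t).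

Lemma clamp_in t : unit_interval (clamp t).
Proof.
unfold clamp, unit_interval, Rmax, Rmin.
destruct (Rle_dec 1 t); destruct (Rle_dec 0 _); lra.
Qed.

Lemma clamp_id t : unit_interval t -> clamp t = t.
Proof.
unfold clamp, unit_interval, Rmax, Rmin; intros h.
destruct (Rle_dec 1 t); destruct (Rle_dec 0 _); lra.
Qed.

Lemma clamp_ge t : 1 <= t -> clamp t = 1.
Proof.
unfold clamp, Rmax, Rmin; intros h.
destruct (Rle_dec 1 t); destruct (Rle_dec 0 _); lra.
Qed.

Lemma clamp_le t : t <= 0 -> clamp t = 0.
Proof.
unfold clamp, Rmax, Rmin; intros h.
destruct (Rle_dec 1 t); destruct (Rle_dec 0 _); lra.
Qed.

Lemma clamp_lip t t' : Rabs (clamp t' - clamp t) <= Rabs (t' - t).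
Proof.
unfold clamp, Rmax, Rmin.
destruct (Rle_dec 1 t); destruct (Rle_dec 1 t');
  repeat destruct (Rle_dec 0 _); unfold Rabs; repeat destruct (Rcase_abs _); lra.
Qed.

(** Precomposing with a clamped affine change of the first variable turns a
    map continuous on the unit square into one continuous on the plane. *)
Lemma continuous_clamp (H : R * R -> C) (a b : R) :
  continuous_on (fun p : R * R => unit_interval (fst p) /\ unit_interval (snd p)) H ->
  forall p : R * R,
    continuous (fun p : R * R => H (clamp (a * fst p + b), clamp (snd p))) p.
Proof.
intros hH [t s].
set (q := (clamp (a * t + b), clamp s)).
refine (filterlim_comp _ _ _
  (fun p : R * R => (clamp (a * fst p + b), clamp (snd p))) H _
  (within (fun p : R * R => unit_interval (fst p) /\ unit_interval (snd p))
     (locally q)) _ _ _).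
- intros P [e he].
  assert (hd : 0 < e / (Rabs a + 1)).
  { apply Rdiv_lt_0_compat; [apply cond_pos | generalize (Rabs_pos a); lra]. }
  assert (hd' : 0 < Rmin e (e / (Rabs a + 1))).
  { apply Rmin_pos; [apply cond_pos | exact hd]. }
  exists (mkposreal _ hd'); intros [t' s'] [ht hs]; simpl in ht, hs.
  apply he; [split | split; apply clamp_in]; simpl.
  + change (Rabs (clamp (a * t' + b) - clamp (a * t + b)) < e).
    change (Rabs (t' - t) < Rmin e (e / (Rabs a + 1))) in ht.
    eapply Rle_lt_trans; [apply clamp_lip |].
    replace (a * t' + b - (a * t + b)) with (a * (t' - t)) by ring.
    rewrite Rabs_mult.
    apply Rle_lt_trans with ((Rabs a + 1) * Rabs (t' - t)).
    { generalize (Rabs_pos (t' - t)); lra. }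
    apply Rlt_le_trans with ((Rabs a + 1) * (e / (Rabs a + 1))).
    { apply Rmult_lt_compat_l; [generalize (Rabs_pos a); lra |].
      eapply Rlt_le_trans; [exact ht | apply Rmin_r]. }
    right; field; generalize (Rabs_pos a); lra.
  + change (Rabs (clamp s' - clamp s) < e).
    change (Rabs (s' - s) < Rmin e (e / (Rabs a + 1))) in hs.
    eapply Rle_lt_trans; [apply clamp_lip |].
    eapply Rlt_le_trans; [exact hs | apply Rmin_l].
- apply hH; split; apply clamp_in.
Qed.

Lemma homotopic_sym X u (g g' : loop X u) : homotopic g g' -> homotopic g' g.
Proof.
intros (H & hc & hin & h0 & h1 & hu).
exists (fun p => H (clamp (-1 * fst p + 1), clamp (snd p))).
repeat split.
- apply continuous_on_forall; intros p _; now apply continuous_clamp.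
- intros t s _ _; apply hin; apply clamp_in.
- intros s hs; simpl; rewrite (clamp_id s hs), clamp_ge by lra; now apply h1.
- intros s hs; simpl; rewrite (clamp_id s hs), clamp_le by lra; now apply h0.
- simpl; rewrite (clamp_le 0) by lra; apply hu, clamp_in.
- simpl; rewrite (clamp_ge 1) by lra; apply hu, clamp_in.
Qed.

Lemma homotopic_trans X u (g1 g2 g3 : loop X u) :
  homotopic g1 g2 -> homotopic g2 g3 -> homotopic g1 g3.
Proof.
intros (H & hc & hin & h0 & h1 & hu) (K & kc & kin & k0 & k1 & ku).
set (G := fun p : R * R =>
  (H (clamp (2 * fst p + 0), clamp (snd p))
   + (K (clamp (2 * fst p + -1), clamp (snd p))
      - H (clamp (0 * fst p + 1), clamp (snd p))))%C).
assert (eq1 : forall t s, t <= / 2 -> G (t, s) = H (clamp (2 * t), clamp s)).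
{ intros t s ht; unfold G; simpl fst; simpl snd.
  rewrite (clamp_le (2 * t + -1)), (clamp_ge (0 * t + 1)) by lra.
  rewrite h1, k0 by apply clamp_in.
  rewrite Rplus_0_r; ring. }
assert (eq2 : forall t s, / 2 <= t -> G (t, s) = K (clamp (2 * t - 1), clamp s)).
{ intros t s ht; unfold G; simpl fst; simpl snd.
  rewrite (clamp_ge (2 * t + 0)), (clamp_ge (0 * t + 1)) by lra.
  replace (2 * t + -1) with (2 * t - 1) by ring; ring. }
exists G; repeat split.
- apply continuous_on_forall; intros p _.
  apply (continuous_plus (V := C_R_NormedModule)).
  { exact (continuous_clamp H 2 0 hc p). }
  apply (continuous_minus (V := C_R_NormedModule)).
  + exact (continuous_clamp K 2 (-1) kc p).
  + exact (continuous_clamp H 0 1 hc p).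
- intros t s _ _; destruct (Rle_dec t (/ 2)).
  + rewrite eq1 by trivial; apply hin; apply clamp_in.
  + rewrite eq2 by lra; apply kin; apply clamp_in.
- intros s hs; rewrite eq1, clamp_le, clamp_id by (trivial; lra); now apply h0.
- intros s hs; rewrite eq2, clamp_ge, clamp_id by (trivial; lra); now apply k1.
- destruct (Rle_dec t (/ 2)).
  + rewrite eq1, (clamp_le 0) by lra; apply hu, clamp_in.
  + rewrite eq2, (clamp_le 0) by lra; apply ku, clamp_in.
- destruct (Rle_dec t (/ 2)).
  + rewrite eq1, (clamp_ge 1) by lra; apply hu, clamp_in.
  + rewrite eq2, (clamp_ge 1) by lra; apply ku, clamp_in.
Qed.

(** The underlying set of the fundamental group; its multiplication plays no
    role in deciding whether two automorphisms are equal. *)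
Definition pi1 (X : C -> Prop) (u : C) : Type :=
  {c : loop X u -> Prop | exists g, c = homotopic g}.

Definition partial_x (f : C -> R) (z : C) : R :=
  Derive (fun x => f (x, Im z)) (Re z).

Definition partial_y (f : C -> R) (z : C) : R :=
  Derive (fun y => f (Re z, y)) (Im z).

Fixpoint Ck (k : nat) (U : C -> Prop) (f : C -> R) : Prop :=
  match k with
  | O => forall z, U z -> continuous f z
  | S k' =>
      (forall z, U z ->
         ex_derive (fun x => f (x, Im z)) (Re z) /\
         ex_derive (fun y => f (Re z, y)) (Im z))
      /\ Ck k' U (partial_x f) /\ Ck k' U (partial_y f)
  end.

(** To be used for open [U] only. *)
Definition smooth_open (U : C -> Prop) (f : C -> C) : Prop :=
  forall k, Ck k U (fun z => Re (f z)) /\ Ck k U (fun z => Im (f z)).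

(** Smoothness (in the real sense) on a subset that need not be open: local
    extendability to a smooth map. *)
Definition smooth_on (A : C -> Prop) (f : C -> C) : Prop :=
  forall z, A z -> exists (U : C -> Prop) (g : C -> C),
    open U /\ U z /\ smooth_open U g /\ (forall w, U w -> A w -> f w = g w).

Definition is_diffeo (f : C -> C) : Prop :=
  exists g : C -> C,
    (forall y, D y -> D (f y) /\ g (f y) = y)
    /\ (forall y, D y -> D (g y) /\ f (g y) = y)
    /\ smooth_on D f /\ smooth_on D g.

(** Only the values of [diffeo_map] on [D] matter. *)
Record diffeo (K : C -> Prop) := Diffeo {
  diffeo_map :> C -> C;
  diffeo_is_diffeo : is_diffeo diffeo_map;
  diffeo_preserves : forall y, D y -> (K (diffeo_map y) <-> K y);
  diffeo_boundary : forall y, Cmod y = 4 -> diffeo_map y = y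
}.

Definition complement (K : C -> Prop) (y : C) : Prop := D y /\ ~ K y.

Lemma smooth_on_continuous A f : smooth_on A f -> continuous_on A f.
Proof.
intros hf z hz; destruct (hf z hz) as (U & g & hU & hUz & hg & hfg).
destruct (hg O) as [h1 h2].
rewrite (hfg z hUz hz); intros P [e he].
unfold filtermap, within.
generalize (hU z hUz) (proj1 (filterlim_locally _ _) (h1 z hUz) e)
  (proj1 (filterlim_locally _ _) (h2 z hUz) e).
intros l1 l2 l3.
generalize (filter_and _ _ l1 (filter_and _ _ l2 l3)); apply filter_imp.
intros w (hw & hr & hi) ha; apply he.
rewrite (hfg w hw ha); split; [exact hr | exact hi].
Qed.

Lemma diffeo_in_complement (K : C -> Prop) (f : diffeo K) y :
  complement K y -> complement K (f y).
Proof.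
intros [hy hK]; destruct (diffeo_is_diffeo K f) as (g & h & _).
split; [now apply h |].
intros hf; apply hK; now apply (diffeo_preserves K f).
Qed.

Lemma diffeo_u0 (K : C -> Prop) (f : diffeo K) : f u0 = u0.
Proof.
apply diffeo_boundary; unfold u0.
replace (- RtoC 4 * Ci)%C with (RtoC (-4) * Ci)%C
  by (apply injective_projections; simpl; ring).
rewrite Cmod_mult, Cmod_R, Rabs_left by lra.
unfold Cmod; simpl.
replace (0 * (0 * 1) + 1 * (1 * 1)) with 1 by ring; rewrite sqrt_1; ring.
Qed.

Lemma diffeo_continuous (K : C -> Prop) (f : diffeo K) : continuous_on D f.
Proof.
destruct (diffeo_is_diffeo K f) as (g & _ & _ & h & _).
now apply smooth_on_continuous.
Qed.

Lemma continuous_on_diffeo_comp (K : C -> Prop) (f : diffeo K)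
    (T : UniformSpace) (A : T -> Prop) (h : T -> C) :
  continuous_on A h -> (forall x, A x -> D (h x)) ->
  continuous_on A (fun x => f (h x)).
Proof.
intros hc hD x hx P hP.
generalize (hc x hx _ (diffeo_continuous K f (h x) (hD x hx) P hP)).
unfold filtermap, within; apply filter_imp; intros y hy hA; auto.
Qed.

Definition loop_map {K : C -> Prop} (f : diffeo K)
    (g : loop (complement K) u0) : loop (complement K) u0.
Proof.
refine (Loop _ _ (fun s => f (g s)) _ _ _ _).
- apply continuous_on_diffeo_comp; [apply path_cont |].
  intros s hs; apply (path_in _ _ g s hs).
- intros s hs; apply diffeo_in_complement, path_in, hs.
- rewrite path_0; apply diffeo_u0.
- rewrite path_1; apply diffeo_u0.
Defined.

Lemma homotopic_loop_map (K : C -> Prop) (f : diffeo K)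
    (g g' : loop (complement K) u0) :
  homotopic g g' -> homotopic (loop_map f g) (loop_map f g').
Proof.
intros (H & hc & hin & h0 & h1 & hu).
exists (fun p => f (H p)); repeat split.
- apply continuous_on_diffeo_comp; trivial.
  intros [t s] [ht hs]; now apply hin.
- destruct (diffeo_in_complement K f _ (hin t s H0 H1)); trivial.
- destruct (diffeo_in_complement K f _ (hin t s H0 H1)); trivial.
- intros s hs; simpl; now rewrite h0.
- intros s hs; simpl; now rewrite h1.
- simpl; rewrite (proj1 (hu t H0)); apply diffeo_u0.
- simpl; rewrite (proj2 (hu t H0)); apply diffeo_u0.
Qed.

Lemma pi1_map_class (K : C -> Prop) (f : diffeo K) (c : pi1 (complement K) u0) :
  exists g, (fun g' => exists g0, proj1_sig c g0 /\ homotopic (loop_map f g0) g')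
            = homotopic g.
Proof.
destruct c as [c [g ->]]; exists (loop_map f g); simpl.
apply functional_extensionality; intros g'; apply propositional_extensionality.
split.
- intros (g0 & h & h'); apply (homotopic_trans _ _ _ (loop_map f g0)); trivial.
  now apply homotopic_loop_map.
- intros h; exists g; split; [apply homotopic_refl | trivial].
Qed.

Definition pi1_map {K : C -> Prop} (f : diffeo K) (c : pi1 (complement K) u0) :
    pi1 (complement K) u0 :=
  exist _ _ (pi1_map_class K f c).

Definition same_automorphism {K : C -> Prop} (f g : diffeo K) : Prop :=
  pi1_map f = pi1_map g.

(** The underlying set of [B_n[D, K]], [n] being the cardinality of [K]. *)
Definition braid_group (K : C -> Prop) : Type :=
  {c : diffeo K -> Prop | exists f, c = same_automorphism f}.

Definition braid_class {K : C -> Prop} (f : diffeo K) : braid_group K :=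
  exist _ (same_automorphism f) (ex_intro _ f eq_refl).

(** Only the [m i] with [i < n] matter. *)
Definition is_motion (K : C -> Prop) (n : nat) (m : nat -> R -> C) : Prop :=
  (forall i, (i < n)%nat -> continuous_on unit_interval (m i))
  /\ (forall i t, (i < n)%nat -> unit_interval t -> D (m i t))
  /\ (forall i j t, (i < n)%nat -> (j < n)%nat -> unit_interval t ->
        i <> j -> m i t <> m j t)
  /\ (forall y, K y <-> exists i, (i < n)%nat /\ m i 0 = y)
  /\ (forall y, K y <-> exists i, (i < n)%nat /\ m i 1 = y).

Definition realizes (n : nat) (m : nat -> R -> C) (Dt : R -> C -> C) : Prop :=
  (forall t, unit_interval t ->
     is_diffeo (Dt t)
     /\ (forall y, Cmod y = 4 -> Dt t y = y)
     /\ (forall i, (i < n)%nat -> Dt t (m i 0) = m i t))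
  /\ (forall y, D y -> Dt 0 y = y)
  /\ continuous_on (fun p : R * C => unit_interval (fst p) /\ D (snd p))
       (fun p : R * C => Dt (fst p) (snd p)).

Definition induces (K : C -> Prop) (n : nat) (m : nat -> R -> C)
    (b : braid_group K) : Prop :=
  is_motion K n m
  /\ exists (Dt : R -> C -> C) (f : diffeo K),
       realizes n m Dt /\ (forall y, D y -> f y = Dt 1 y) /\ b = braid_class f.

Definition fiber (S : C -> C -> Prop) (x y : C) : Prop := S x y.

Definition cis (a : R) : C := (cos a, sin a).

(** The fibre of [S] over [x = 1] is the set [K]; [n] is the cardinality of the
    fibres over [x <> 0]. *)
Definition is_local_braid_monodromy (S : C -> C -> Prop) (n : nat)
    (b : braid_group (fiber S (RtoC 1))) : Prop :=
  exists m : nat -> R -> C,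
    (forall t, unit_interval t -> forall y,
       fiber S (cis (2 * PI * t)) y <-> exists i, (i < n)%nat /\ m i t = y)
    /\ induces (fiber S (RtoC 1)) n m b.

Definition curve (x y : C) : Prop :=
  E x /\ D y
  /\ ((RtoC 2 * x + y) * (RtoC 2 * x - y) * (y + x * x) * (y - x * x)
      = RtoC 0)%C.

Definition concat_motion (m m' : nat -> R -> C) (i : nat) (t : R) : C :=
  if Rle_dec t (1 / 2) then m i (2 * t) else m' i (2 * t - 1).

(** The indices 0, 1, 2, 3 label the points 1, -1, 2, -2 of [K]. *)
Definition inner_full_twists (i : nat) (t : R) : C :=
  match i with
  | 0%nat => cis (4 * PI * t)
  | 1%nat => (- cis (4 * PI * t))%C
  | 2%nat => RtoC 2
  | _ => (- RtoC 2)%C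
  end.

Definition outer_full_twist (i : nat) (t : R) : C :=
  match i with
  | 0%nat => RtoC 1
  | 1%nat => (- RtoC 1)%C
  | 2%nat => (RtoC 2 * cis (2 * PI * t))%C
  | _ => (- (RtoC 2 * cis (2 * PI * t)))%C
  end.

(* Main.v *)
From Stdlib Require Import Lra Lia IndefiniteDescription ProofIrrelevance.
Require Import Defs.
From Stdlib Require Import Reals.
From Coquelicot Require Import Coquelicot.
Local Open Scope R_scope.

(** A single diffeomorphism realizes the end of both motions. Over
    [x = cis (2 * PI * t)] the curve has the points [±x^2], turning about 0 by
    [4 * PI * t] on the circle of radius 1, and [±2 * x], turning by
    [2 * PI * t] on the circle of radius 2. Hence [twist a b], the rotation of
    every circle [|z| = r] by an angle [a * p (r^2) + b * q (r^2)], carries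
    [K] to the fibre when [a = b = t], provided that [p] and [q] are
    quadratic polynomials with [p = 4 * PI, 0, 0] and [q = 0, 2 * PI, 0] at
    [r = 1, 2, 4]. Letting [a] grow from 0 to 1 first and [b] afterwards
    realizes the concatenated motion instead ([twist_motion_induces] covers
    both). Since the two families end with the same map [twist 1 1], the two
    motions induce the same braid.

    What remains is that a motion has only one braid
    ([same_points_same_braid]). If [F] and [F'] are families of
    diffeomorphisms moving [K] through the same sets of points, then
    [F'_1 o F'_t^-1 o F_t] preserves [K] for each [t], hence applying it to a
    loop [g] gives a homotopy in the complement of [K] from [F'_1 o g] to
    [F_1 o g]. Only the sets of points matter here, not their labels; so the
    lemma also disposes of the choice of a labelling of the fibres. Its
    analytic content is that [F'_t^-1] is jointly continuous, which follows
    from the compactness of the disc ([continuous_inverse_family]). *)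

Local Notation C := Complex.C.
Local Notation D := Defs.D.

(** * Inverting a continuous family of bijections of the disc *)

Lemma D_square w : D w -> -4 <= fst w <= 4 /\ -4 <= snd w <= 4.
Proof.
unfold D; intros h.
generalize (Rmax_Cmod w); intros h'.
generalize (Rmax_l (Rabs (fst w)) (Rabs (snd w)))
  (Rmax_r (Rabs (fst w)) (Rabs (snd w))); intros h1 h2.
split; apply Rabs_le_between; lra.
Qed.

(** Stated with [locally] because the balls of the product structure on the
    complex plane are squares, whereas [D] is round. *)
Lemma D_not_locally w : ~ D w -> locally w (fun z => ~ D z).
Proof.
unfold D; intros h; apply Rnot_le_lt in h.
assert (hd : 0 < (Cmod w - 4) / 2) by lra.
exists (mkposreal _ hd); intros z [h1 h2]; simpl in h1, h2.
intros hz.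
change (Rabs (fst z - fst w) < (Cmod w - 4) / 2) in h1.
change (Rabs (snd z - snd w) < (Cmod w - 4) / 2) in h2.
assert (htri : Cmod w <= Cmod z + Cmod (w - z)%C).
{ replace w with (z + (w - z))%C at 1 by ring; apply Cmod_triangle. }
assert (hlip : Cmod (w - z)%C <= Rabs (fst z - fst w) + Rabs (snd z - snd w)).
{ replace (w - z)%C with (RtoC (fst w - fst z) + RtoC (snd w - snd z) * Ci)%C
    by (destruct w, z; apply injective_projections; simpl; ring).
  eapply Rle_trans; [apply Cmod_triangle |].
  rewrite Cmod_mult, !Cmod_R.
  replace (Cmod Ci) with 1.
  - rewrite (Rabs_minus_sym (fst w)), (Rabs_minus_sym (snd w)); lra.
  - unfold Cmod; simpl.
    replace (0 * (0 * 1) + 1 * (1 * 1)) with 1 by ring; now rewrite sqrt_1. }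
lra.
Qed.

Lemma separated (x y : C) :
  x <> y -> exists e : posreal, forall z, ball x e z -> ball y e z -> False.
Proof.
intros h; apply Classical_Prop.NNPP; intros hn; apply h.
apply (eq_close (V := C_R_NormedModule)); intros e.
apply Classical_Prop.NNPP; intros hb; apply hn.
assert (he : 0 < e / 2) by (generalize (cond_pos e); lra).
exists (mkposreal _ he); intros z h1 h2; apply hb.
replace (pos e) with (e / 2 + e / 2) by field.
eapply ball_triangle; [exact h1 | apply ball_sym; exact h2].
Qed.

Definition cylinder (p : R * C) : Prop :=
  unit_interval (fst p) /\ D (snd p).

(** Properness of the disc: near [(t0, y0)] no point [z] away from
    [z0 = G t0 y0] can satisfy [F t z = y], since every [w <> z0] of the disc has
    a neighbourhood whose image stays away from [y0], and finitely many of
    these suffice. *)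
Lemma continuous_inverse_family (F G : R -> C -> C) :
  continuous_on cylinder (fun p => F (fst p) (snd p)) ->
  (forall t y, unit_interval t -> D y -> D (G t y) /\ F t (G t y) = y) ->
  (forall t y, unit_interval t -> D y -> G t (F t y) = y) ->
  continuous_on cylinder (fun p => G (fst p) (snd p)).
Proof.
intros hF hG hGF [t0 y0] h0; destruct (h0) as [ht0 hy0]; simpl in ht0, hy0.
simpl fst; simpl snd; set (z0 := G t0 y0).
apply filterlim_locally; intros eps.
assert (he : 0 < eps / 2) by (generalize (cond_pos eps); lra).
(* The neighbourhoods are to cover the square around the disc, whence the case
   of a point outside [D]. *)
assert (hloc : forall u v, exists d : posreal, forall z t y,
  ball (u, v) d z -> ball (t0, y0) d (t, y) -> cylinder (t, y) -> z = G t y ->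
  ball z0 eps z).
{ intros u v.
  destruct (Classical_Prop.classic (ball z0 (eps / 2) (u, v))) as [hnear | hfar].
  { exists (mkposreal _ he); intros z t y hz _ _ _.
    replace (pos eps) with (eps / 2 + eps / 2) by field.
    eapply ball_triangle; [exact hnear | exact hz]. }
  destruct (Classical_Prop.classic (D (u, v))) as [hD | hD].
  - assert (hne : F t0 (u, v) <> y0).
    { intros hy; apply hfar; unfold z0; rewrite <- hy, hGF; trivial.
      apply (ball_center (u, v) (mkposreal _ he)). }
    destruct (separated _ _ hne) as [e hsep].
    destruct (proj1 (filterlim_locally _ _) (hF (t0, (u, v)) (conj ht0 hD)) e)
      as [d hd].
    assert (hm : 0 < Rmin d e) by (apply Rmin_pos; apply cond_pos).
    exists (mkposreal _ hm); intros z t y hz [ht hy] [hIt hDy] hzG; exfalso.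
    simpl in ht, hy, hIt, hDy.
    destruct (hG t y hIt hDy) as [hGD hFG].
    apply (hsep y).
    + rewrite <- hFG; apply (hd (t, G t y)); [| now split].
      split; simpl.
      * eapply ball_le; [| exact ht]; apply Rmin_l.
      * rewrite <- hzG; eapply ball_le; [| exact hz]; apply Rmin_l.
    + eapply ball_le; [| exact hy]; apply Rmin_r.
  - destruct (D_not_locally _ hD) as [d hd].
    exists d; intros z t y hz _ [hIt hDy] hzG; exfalso.
    apply (hd z hz); rewrite hzG; now apply hG. }
assert (hdelta : exists delta : R * R -> posreal, forall uv z t y,
  ball uv (delta uv) z -> ball (t0, y0) (delta uv) (t, y) ->
  cylinder (t, y) -> z = G t y -> ball z0 eps z).
{ apply (functional_choice (fun (uv : R * R) (d : posreal) => forall z t y,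
    ball uv d z -> ball (t0, y0) d (t, y) -> cylinder (t, y) -> z = G t y ->
    ball z0 eps z)).
  intros [u v]; apply hloc. }
destruct hdelta as [delta hdelta].
destruct (compactness_value_2d (-4) 4 (-4) 4 (fun u v => delta (u, v)))
  as [d hd].
exists d; intros [t y] hty hc.
destruct (hG t y (proj1 hc) (proj2 hc)) as [hGD _].
destruct (D_square _ hGD) as [hre him].
apply Classical_Prop.NNPP; intros hcontra.
apply (hd _ _ hre him); intros (u & v & _ & _ & hu & hv & hle).
apply hcontra; apply (hdelta (u, v) (G t y) t y); trivial.
- split; [exact hu | exact hv].
- eapply ball_le; [exact hle | exact hty].
Qed.

(** * The braid of a motion depends only on the moving set of points *)

Lemma homotopic_same_automorphism (K : C -> Prop) (f f' : diffeo K) :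
  (forall g, homotopic (loop_map f g) (loop_map f' g)) ->
  braid_class f = braid_class f'.
Proof.
intros h.
assert (heq : pi1_map f = pi1_map f').
{ apply FunctionalExtensionality.functional_extensionality; intros c.
  apply subset_eq_compat.
  apply FunctionalExtensionality.functional_extensionality; intros g.
  apply PropExtensionality.propositional_extensionality.
  split; intros (g0 & h0 & h1); exists g0; split; trivial.
  - now apply (homotopic_trans _ _ _ (loop_map f g0)); [apply homotopic_sym |].
  - now apply (homotopic_trans _ _ _ (loop_map f' g0)). }
apply subset_eq_compat.
unfold same_automorphism; now rewrite heq.
Qed.

Lemma u0_boundary : Cmod u0 = 4.
Proof.
unfold u0.
replace (- RtoC 4 * Ci)%C with (RtoC (-4) * Ci)%C
  by (apply injective_projections; simpl; ring).
rewrite Cmod_mult, Cmod_R, Rabs_left by lra.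
unfold Cmod; simpl.
replace (0 * (0 * 1) + 1 * (1 * 1)) with 1 by ring; rewrite sqrt_1; ring.
Qed.

Lemma continuous_on_comp_within (T U V : UniformSpace) (A : T -> Prop)
    (B : U -> Prop) (f : T -> U) (g : U -> V) :
  continuous_on A f -> (forall x, A x -> B (f x)) -> continuous_on B g ->
  continuous_on A (fun x => g (f x)).
Proof.
intros hf hAB hg x hx P hP.
generalize (hf x hx _ (hg (f x) (hAB x hx) P hP)).
unfold filtermap, within; apply filter_imp; intros y hy hA; auto.
Qed.

Lemma continuous_on_pair (T U V : UniformSpace) (A : T -> Prop)
    (f : T -> U) (g : T -> V) :
  continuous_on A f -> continuous_on A g ->
  continuous_on A (fun x => (f x, g x)).
Proof.
intros hf hg x hx; apply filterlim_locally; intros e.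
generalize (proj1 (filterlim_locally _ _) (hf x hx) e)
  (proj1 (filterlim_locally _ _) (hg x hx) e).
intros l1 l2; generalize (filter_and _ _ l1 l2); apply filter_imp.
intros y [h1 h2]; now split.
Qed.

(** The homotopy is [F'_1 o F'_t^-1 o F_t o g]. At time [t] the loop [F_t o g]
    avoids the moving points, because [F_t] is injective and these points are
    [F_t K]; they are also [F'_t K], so that [F'_t^-1] brings the loop back to
    the complement of [K]. *)
Lemma same_points_same_braid (K : C -> Prop) (n n' : nat)
    (m m' : nat -> R -> C) (b b' : braid_group K) :
  (forall t, unit_interval t -> forall y,
     (exists i, (i < n)%nat /\ m i t = y) <->
     (exists i, (i < n')%nat /\ m' i t = y)) ->
  induces K n m b -> induces K n' m' b' -> b = b'.
Proof.
intros hmm (hm & F & f & (hF & hF0 & hFc) & hf & ->)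
  (hm' & F' & f' & (hF' & hF'0 & hF'c) & hf' & ->).
destruct hm as (_ & hmD & _ & hK & _), hm' as (_ & hmD' & _ & hK' & _).
assert (h0 : unit_interval 0) by (unfold unit_interval; lra).
assert (h1 : unit_interval 1) by (unfold unit_interval; lra).
assert (hu : D u0) by (unfold D; rewrite u0_boundary; lra).
assert (hex : exists G : R -> C -> C, forall t, unit_interval t ->
  (forall y, D y -> D (F' t y) /\ G t (F' t y) = y)
  /\ (forall y, D y -> D (G t y) /\ F' t (G t y) = y)).
{ apply (functional_choice (fun t g => unit_interval t ->
    (forall y, D y -> D (F' t y) /\ g (F' t y) = y)
    /\ (forall y, D y -> D (g y) /\ F' t (g y) = y))).
  intros t; destruct (Classical_Prop.classic (unit_interval t)) as [ht | ht].
  - destruct (hF' t ht) as ((g & hg & hg' & _) & _); now exists g.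
  - exists (fun y => y); tauto. }
destruct hex as [G hG].
assert (hGc : continuous_on cylinder (fun p => G (fst p) (snd p))).
{ apply (continuous_inverse_family F').
  - exact hF'c.
  - intros t y ht hy; now apply hG.
  - intros t y ht hy; now apply hG. }
assert (hFD : forall t y, unit_interval t -> D y -> D (F t y)).
{ intros t y ht hy; destruct (hF t ht) as ((g & hg & _) & _); now apply hg. }
assert (hFinj : forall t y z, unit_interval t -> D y -> D z ->
  F t y = F t z -> y = z).
{ intros t y z ht hy hz hyz; destruct (hF t ht) as ((g & hg & _) & _).
  destruct (hg y hy) as [_ <-], (hg z hz) as [_ <-]; now f_equal. }
assert (hGu : forall t, unit_interval t -> G t (F t u0) = u0).
{ intros t ht; destruct (hF t ht) as (_ & hb & _), (hF' t ht) as (_ & hb' & _).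
  rewrite hb by apply u0_boundary.
  rewrite <- (hb' u0 u0_boundary) at 1; now apply hG. }
apply homotopic_same_automorphism; intros g.
apply homotopic_sym.
assert (hgD : forall s, unit_interval s -> D (g s)).
{ intros s hs; apply (path_in _ _ g s hs). }
exists (fun p => f' (G (fst p) (F (fst p) (g (snd p))))).
split; [| split; [| split; [| split]]].
- apply continuous_on_diffeo_comp.
  + apply (continuous_on_comp_within _ _ _ _ cylinder
      (fun p : R * R => (fst p, F (fst p) (g (snd p))))
      (fun p => G (fst p) (snd p))); trivial.
    * apply continuous_on_pair.
      { apply continuous_on_forall; intros [t s] _; apply continuous_fst. }
      apply (continuous_on_comp_within _ _ _ _ cylinder
        (fun p : R * R => (fst p, g (snd p)))
        (fun p => F (fst p) (snd p))); trivial.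
      -- apply continuous_on_pair.
         { apply continuous_on_forall; intros [t s] _; apply continuous_fst. }
         apply (continuous_on_comp_within _ _ _ _ unit_interval
           (fun p : R * R => snd p) g).
         ++ apply continuous_on_forall; intros [t s] _; apply continuous_snd.
         ++ now intros p [].
         ++ apply path_cont.
      -- intros [t s] [ht hs]; split; simpl; auto.
    * intros [t s] [ht hs]; split; simpl; auto.
  + intros [t s] [ht hs]; simpl; apply hG; auto.
- intros t s ht hs; simpl.
  apply diffeo_in_complement; split; [apply hG; auto |].
  intros hKy; destruct (proj1 (hK' _) hKy) as (i & hi & hyi).
  destruct (proj2 (hmm t ht (m' i t)) (ex_intro _ i (conj hi eq_refl)))
    as (j & hj & hji).
  apply (proj2 (path_in _ _ g s hs)), hK; exists j; split; trivial.
  apply (hFinj t); auto.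
  rewrite (proj2 (proj2 (hF t ht)) j hj), hji.
  rewrite <- (proj2 (proj2 (hF' t ht)) i hi), hyi.
  apply hG; auto.
- intros s hs; simpl; f_equal.
  rewrite hF0 by auto; rewrite <- (hF'0 (g s)) at 1 by auto; apply hG; auto.
- intros s hs; simpl.
  rewrite hf' by (apply hG; auto); rewrite hf by auto; apply hG; auto.
- intros t ht; simpl; rewrite path_0, path_1, hGu by trivial.
  split; apply diffeo_u0.
Qed.

(** * Smooth maps given by trigonometric expressions *)

(** A class of functions closed under partial derivatives, by which smoothness
    of any order is a single induction. The parameters of a family of
    maps are variables on a par with the coordinates of the point, so that
    joint continuity comes from the same expressions. *)
Inductive trig_term : Type :=
  | Const (c : R)
  | Var (i : nat)
  | Add (e e' : trig_term)
  | Mul (e e' : trig_term)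
  | Cos (e : trig_term)
  | Sin (e : trig_term).

Fixpoint eval (env : nat -> R) (e : trig_term) : R :=
  match e with
  | Const c => c
  | Var i => env i
  | Add e e' => eval env e + eval env e'
  | Mul e e' => eval env e * eval env e'
  | Cos e => cos (eval env e)
  | Sin e => sin (eval env e)
  end.

Fixpoint deriv (i : nat) (e : trig_term) : trig_term :=
  match e with
  | Const c => Const 0
  | Var j => Const (if Nat.eqb j i then 1 else 0)
  | Add e e' => Add (deriv i e) (deriv i e')
  | Mul e e' => Add (Mul (deriv i e) e') (Mul e (deriv i e'))
  | Cos e => Mul (deriv i e) (Mul (Const (-1)) (Sin e))
  | Sin e => Mul (deriv i e) (Cos e)
  end.

Lemma continuous_eval (T : UniformSpace) (env : T -> nat -> R) (x : T) e :
  (forall i, continuous (fun y => env y i) x) ->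
  continuous (fun y => eval (env y) e) x.
Proof.
intros h; induction e; simpl.
- apply continuous_const.
- apply h.
- now apply (continuous_plus (V := R_NormedModule)).
- now apply (continuous_mult (K := R_AbsRing)).
- apply (continuous_comp _ cos); [assumption | apply continuous_cos].
- apply (continuous_comp _ sin); [assumption | apply continuous_sin].
Qed.

Lemma is_derive_eval (env : R -> nat -> R) (i : nat) (u : R) e :
  (forall j, is_derive (fun s => env s j) u (if Nat.eqb j i then 1 else 0)) ->
  is_derive (fun s => eval (env s) e) u (eval (env u) (deriv i e)).
Proof.
intros h; induction e; simpl.
- apply (is_derive_const (V := R_NormedModule)).
- apply h.
- now apply (is_derive_plus (V := R_NormedModule)).
- apply (is_derive_mult (K := R_AbsRing)); trivial; exact Rmult_comm.
- replace (-1 * sin (eval (env u) e)) with (- sin (eval (env u) e)) by ring.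
  apply (is_derive_comp cos); [apply is_derive_cos | assumption].
- apply (is_derive_comp sin); [apply is_derive_sin | assumption].
Qed.

(** Variables 0 and 1 are the coordinates of the point, along which one
    differentiates; 2 and 3 are the parameters of the family. *)
Definition point_env (a b : R) (z : C) (i : nat) : R :=
  match i with
  | 0%nat => Re z
  | 1%nat => Im z
  | 2%nat => a
  | _ => b
  end.

(** The induction on [k] works because the partial derivatives of [eval] at
    [e] are again values of [eval]; only continuity has to be checked at the
    bottom. *)
Lemma Ck_eval a b k U e : Ck k U (fun z => eval (point_env a b z) e).
Proof.
assert (hx : forall e z, is_derive
  (fun x => eval (point_env a b (x, Im z)) e) (Re z)
  (eval (point_env a b z) (deriv 0 e))).
{ intros e' [x y]; apply (is_derive_eval (fun x => point_env a b (x, y))).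
  intros [| [| [| j]]]; simpl; [apply (is_derive_id (K := R_AbsRing)) | | |];
    apply (is_derive_const (V := R_NormedModule)). }
assert (hy : forall e z, is_derive
  (fun y => eval (point_env a b (Re z, y)) e) (Im z)
  (eval (point_env a b z) (deriv 1 e))).
{ intros e' [x y]; apply (is_derive_eval (fun y => point_env a b (x, y))).
  intros [| [| [| j]]]; simpl; [| apply (is_derive_id (K := R_AbsRing)) | |];
    apply (is_derive_const (V := R_NormedModule)). }
revert e; induction k as [| k IH]; intros e; simpl.
- intros [x y] _; apply continuous_eval.
  intros [| [| [| i]]]; simpl.
  + apply continuous_fst.
  + apply continuous_snd.
  + apply continuous_const.
  + apply continuous_const.
- split; [| split].
  + intros z _; split; eexists; [apply hx | apply hy].
  + replace (partial_x _) with (fun z => eval (point_env a b z) (deriv 0 e));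
      [apply IH |].
    apply FunctionalExtensionality.functional_extensionality; intros z.
    symmetry; apply is_derive_unique, hx.
  + replace (partial_y _) with (fun z => eval (point_env a b z) (deriv 1 e));
      [apply IH |].
    apply FunctionalExtensionality.functional_extensionality; intros z.
    symmetry; apply is_derive_unique, hy.
Qed.

(** * The twisting maps of the disc *)

(** The angle is a polynomial in [r^2] rather than in [r], since [r] is not a
    smooth function at the origin. The denominators make the angle
    [4 * PI] per unit of the first parameter at [r = 1], where
    [(1 - 4) * (1 - 16) = 45], and [2 * PI] per unit of the second one at
    [r = 2], where [(4 - 1) * (4 - 16) = -36]. *)
Definition angle : trig_term :=
  let r2 := Add (Mul (Var 0) (Var 0)) (Mul (Var 1) (Var 1)) in
  Add
    (Mul (Var 2) (Mul (Const (4 * PI / 45))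
       (Mul (Add r2 (Const (-4))) (Add r2 (Const (-16))))))
    (Mul (Var 3) (Mul (Const (- (2 * PI / 36)))
       (Mul (Add r2 (Const (-1))) (Add r2 (Const (-16)))))).

(** The product [cis angle * z], spelled out as a pair of expressions to which
    [Ck_eval] applies; see [twist_cis]. *)
Definition twist (a b : R) (z : C) : C :=
  (eval (point_env a b z)
     (Add (Mul (Var 0) (Cos angle)) (Mul (Const (-1)) (Mul (Var 1) (Sin angle)))),
   eval (point_env a b z) (Add (Mul (Var 0) (Sin angle)) (Mul (Var 1) (Cos angle)))).

Lemma cis_add s t : cis (s + t) = (cis s * cis t)%C.
Proof.
unfold cis; rewrite cos_plus, sin_plus.
apply injective_projections; simpl; ring.
Qed.

Lemma cis_0 : cis 0 = RtoC 1.
Proof. unfold cis; now rewrite cos_0, sin_0. Qed.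

Lemma cis_2PI : cis (2 * PI) = RtoC 1.
Proof. unfold cis; now rewrite cos_2PI, sin_2PI. Qed.

Lemma Cmod_cis t : Cmod (cis t) = 1.
Proof.
unfold Cmod, cis; simpl.
replace (_ + _) with 1; [apply sqrt_1 |].
generalize (sin2_cos2 t); unfold Rsqr; lra.
Qed.

Lemma twist_cis a b z : twist a b z = (cis (eval (point_env a b z) angle) * z)%C.
Proof.
apply injective_projections; simpl; unfold Re, Im; ring.
Qed.

Lemma Cmod_twist a b z : Cmod (twist a b z) = Cmod z.
Proof. rewrite twist_cis, Cmod_mult, Cmod_cis; ring. Qed.

(** The angle as a function of the radius: a twist preserves the radius,
    which is why twists compose by adding their parameters. *)
Definition angle_at (a b r : R) : R :=
  a * (4 * PI / 45 * ((r ^ 2 + -4) * (r ^ 2 + -16)))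
  + b * (- (2 * PI / 36) * ((r ^ 2 + -1) * (r ^ 2 + -16))).

Lemma eval_angle a b z : eval (point_env a b z) angle = angle_at a b (Cmod z).
Proof. unfold angle_at; rewrite Cmod2_alt; simpl; ring. Qed.

Lemma twist_radius a b z : twist a b z = (cis (angle_at a b (Cmod z)) * z)%C.
Proof. now rewrite twist_cis, eval_angle. Qed.

Lemma twist_comp a b a' b' z :
  twist a b (twist a' b' z) = twist (a + a') (b + b') z.
Proof.
rewrite (twist_radius a b), Cmod_twist, !twist_radius, Cmult_assoc, <- cis_add.
do 2 f_equal; unfold angle_at; ring.
Qed.

Lemma twist_0 z : twist 0 0 z = z.
Proof.
rewrite twist_radius; replace (angle_at 0 0 _) with 0 by (unfold angle_at; ring).
rewrite cis_0; ring.
Qed.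

Lemma twist_opp a b z : twist (- a) (- b) (twist a b z) = z.
Proof. rewrite twist_comp, !Rplus_opp_l; apply twist_0. Qed.

Lemma twist_boundary a b z : Cmod z = 4 -> twist a b z = z.
Proof.
intros h; rewrite twist_radius, h.
replace (angle_at a b 4) with 0 by (unfold angle_at; ring).
rewrite cis_0; ring.
Qed.

Lemma twist_inner a b z : Cmod z = 1 -> twist a b z = (cis (4 * PI * a) * z)%C.
Proof.
intros h; rewrite twist_radius, h; do 2 f_equal; unfold angle_at; field.
Qed.

Lemma twist_outer a b z : Cmod z = 2 -> twist a b z = (cis (2 * PI * b) * z)%C.
Proof.
intros h; rewrite twist_radius, h; do 2 f_equal; unfold angle_at; field.
Qed.

Lemma smooth_on_twist a b A : smooth_on A (twist a b).
Proof.
intros z _; exists (fun _ => True), (twist a b); split; [| split; [| split]].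
- apply open_true.
- trivial.
- intros k; split; unfold twist; simpl fst; apply Ck_eval.
- trivial.
Qed.

Lemma twist_is_diffeo a b : is_diffeo (twist a b).
Proof.
exists (twist (- a) (- b)); split; [| split; [| split]].
- intros y hy; split; [unfold D; now rewrite Cmod_twist | apply twist_opp].
- intros y hy; split; [unfold D; now rewrite Cmod_twist |].
  rewrite <- (twist_opp (- a) (- b) y) at 2; now rewrite !Ropp_involutive.
- apply smooth_on_twist.
- apply smooth_on_twist.
Qed.

Lemma continuous_on_twist (T : UniformSpace) (A : T -> Prop)
    (a b : T -> R) (h : T -> C) :
  (forall x, A x -> continuous a x) -> (forall x, A x -> continuous b x) ->
  (forall x, A x -> continuous h x) ->
  continuous_on A (fun x => twist (a x) (b x) (h x)).
Proof.
intros ha hb hh.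
assert (he : forall e x, A x ->
  continuous (fun y => eval (point_env (a y) (b y) (h y)) e) x).
{ intros e x hx; apply continuous_eval; intros [| [| [| i]]]; simpl.
  - apply (continuous_comp h fst); [now apply hh |].
    destruct (h x); apply continuous_fst.
  - apply (continuous_comp h snd); [now apply hh |].
    destruct (h x); apply continuous_snd.
  - now apply ha.
  - now apply hb. }
apply continuous_on_pair; apply continuous_on_forall; intros x hx; now apply he.
Qed.

(** * The curve and its fibres *)

Definition base_point (i : nat) : C :=
  match i with
  | 0%nat => RtoC 1
  | 1%nat => (- RtoC 1)%C
  | 2%nat => RtoC 2
  | _ => (- RtoC 2)%C
  end.

Lemma Cmod_base_point i : Cmod (base_point i) = if Nat.ltb i 2 then 1 else 2.
Proof.
destruct i as [| [| [| i]]]; simpl; rewrite ?Cmod_opp, Cmod_R, Rabs_pos_eq; lra.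
Qed.

(** For [x = cis s] the roots are [±x^2 = ±cis (2 * s)], on the unit circle,
    and [±2 * x]. *)
Lemma curve_fiber s y :
  curve (cis s) y <-> exists i, (i < 4)%nat
    /\ (cis (if Nat.ltb i 2 then 2 * s else s) * base_point i)%C = y.
Proof.
assert (hs : cis (2 * s) = (cis s * cis s)%C).
{ rewrite <- cis_add; f_equal; ring. }
split.
- intros (_ & _ & h).
  assert (h' : (RtoC 2 * cis s + y = RtoC 0 \/ RtoC 2 * cis s - y = RtoC 0
    \/ y + cis s * cis s = RtoC 0 \/ y - cis s * cis s = RtoC 0)%C).
  { apply Classical_Prop.NNPP; intros hn.
    revert h; repeat apply Cmult_neq_0; tauto. }
  destruct h' as [h' | [h' | [h' | h']]].
  + exists 3%nat; split; [lia |]; simpl.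
    replace y with ((RtoC 2 * cis s + y) - RtoC 2 * cis s)%C by ring.
    rewrite h'; ring.
  + exists 2%nat; split; [lia |]; simpl.
    replace y with (RtoC 2 * cis s - (RtoC 2 * cis s - y))%C by ring.
    rewrite h'; ring.
  + exists 1%nat; split; [lia |]; simpl; rewrite hs.
    replace y with ((y + cis s * cis s) - cis s * cis s)%C by ring.
    rewrite h'; ring.
  + exists 0%nat; split; [lia |]; simpl; rewrite hs.
    replace y with ((y - cis s * cis s) + cis s * cis s)%C by ring.
    rewrite h'; ring.
- intros (i & hi & <-); split; [| split].
  + unfold E; rewrite Cmod_cis; lra.
  + unfold D; rewrite Cmod_mult, Cmod_cis, Cmod_base_point.
    destruct (Nat.ltb i 2); lra.
  + destruct i as [| [| [| [| i]]]]; [..| lia]; simpl; rewrite ?hs; ring.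
Qed.

Local Notation K := (fiber curve (RtoC 1)).

Lemma K_base_point y : K y <-> exists i, (i < 4)%nat /\ base_point i = y.
Proof.
unfold fiber; rewrite <- cis_0, curve_fiber.
split; intros (i & hi & h); exists i; split; trivial; rewrite <- h;
  replace (if Nat.ltb i 2 then 2 * 0 else 0) with 0 by (destruct Nat.ltb; ring);
  rewrite cis_0; ring.
Qed.

Lemma twist_base_point a b i : (i < 4)%nat ->
  twist a b (base_point i)
  = (cis (if Nat.ltb i 2 then 4 * PI * a else 2 * PI * b) * base_point i)%C.
Proof.
intros hi; generalize (Cmod_base_point i); destruct (Nat.ltb i 2); intros h.
- now apply twist_inner.
- now apply twist_outer.
Qed.

Lemma full_twist_base_point i : (i < 4)%nat ->
  twist 1 1 (base_point i) = base_point i.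
Proof.
intros hi; rewrite twist_base_point by trivial.
replace (cis _) with (RtoC 1); [ring |].
destruct (Nat.ltb i 2).
- replace (4 * PI * 1) with (2 * PI + 2 * PI) by ring.
  rewrite cis_add, cis_2PI; ring.
- now rewrite Rmult_1_r, cis_2PI.
Qed.

Lemma base_point_inj i j : (i < 4)%nat -> (j < 4)%nat ->
  base_point i = base_point j -> i = j.
Proof.
intros hi hj h; apply (f_equal fst) in h; revert h.
destruct i as [| [| [| [| i]]]], j as [| [| [| [| j]]]]; try lia;
  simpl; intros h; trivial; exfalso; lra.
Qed.

Lemma full_twists_preserve y : D y -> K (twist 1 1 y) <-> K y.
Proof.
intros _; rewrite !K_base_point; split; intros (i & hi & h); exists i; split; trivial.
- rewrite <- (twist_opp 1 1 (base_point i)), full_twist_base_point, h by trivial.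
  apply twist_opp.
- now rewrite <- h, full_twist_base_point.
Qed.

(** * The common braid of the two motions *)

Definition full_twists : diffeo K :=
  Diffeo K (twist 1 1) (twist_is_diffeo 1 1) full_twists_preserve
    (twist_boundary 1 1).

(** Whatever the order in which the two rotations are carried out, the family
    of twists ends with [twist 1 1], whose class is the braid. *)
Lemma twist_motion_induces (a b : R -> R) (m : nat -> R -> C) :
  (forall t, continuous a t) -> (forall t, continuous b t) ->
  a 0 = 0 -> b 0 = 0 -> a 1 = 1 -> b 1 = 1 ->
  (forall i t, (i < 4)%nat -> unit_interval t ->
     m i t = twist (a t) (b t) (base_point i)) ->
  induces K 4 m (braid_class full_twists).
Proof.
intros ha hb a0 b0 a1 b1 hm.
assert (h0 : unit_interval 0) by (unfold unit_interval; lra).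
assert (h1 : unit_interval 1) by (unfold unit_interval; lra).
assert (hm0 : forall i, (i < 4)%nat -> m i 0 = base_point i).
{ intros i hi; rewrite hm by trivial; rewrite a0, b0; apply twist_0. }
assert (hm1 : forall i, (i < 4)%nat -> m i 1 = base_point i).
{ intros i hi; rewrite hm by trivial; rewrite a1, b1.
  now apply full_twist_base_point. }
split; [split; [| split; [| split; [| split]]] |].
- intros i hi.
  apply (continuous_on_ext _ (fun t => twist (a t) (b t) (base_point i))).
  { intros t ht; symmetry; now apply hm. }
  apply continuous_on_twist; auto; intros; apply continuous_const.
- intros i t hi ht; rewrite hm by trivial; unfold D.
  rewrite Cmod_twist, Cmod_base_point; destruct (Nat.ltb i 2); lra.
- intros i j t hi hj ht hij; rewrite !hm by trivial; intros h.
  apply hij, base_point_inj; trivial.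
  rewrite <- (twist_opp (a t) (b t) (base_point i)), h; apply twist_opp.
- intros y; rewrite K_base_point.
  split; intros (i & hi & h); exists i; split; trivial; rewrite <- h;
    [now apply hm0 | symmetry; now apply hm0].
- intros y; rewrite K_base_point.
  split; intros (i & hi & h); exists i; split; trivial; rewrite <- h;
    [now apply hm1 | symmetry; now apply hm1].
- exists (fun t => twist (a t) (b t)), full_twists; split; [| split].
  + split; [| split].
    * intros t ht; split; [apply twist_is_diffeo | split].
      -- intros y hy; now apply twist_boundary.
      -- intros i hi; rewrite hm0 by trivial; symmetry; now apply hm.
    * intros y _; rewrite a0, b0; apply twist_0.
    * apply (continuous_on_twist _ _ (fun p : R * C => a (fst p))
        (fun p : R * C => b (fst p)) (fun p : R * C => snd p)).
      -- intros [t z] _; apply (continuous_comp fst a); [apply continuous_fst | apply ha].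
      -- intros [t z] _; apply (continuous_comp fst b); [apply continuous_fst | apply hb].
      -- intros [t z] _; apply continuous_snd.
  + intros y _; simpl diffeo_map; now rewrite a1, b1.
  + reflexivity.
Qed.

Lemma continuous_clamp_affine c d t : continuous (fun t => clamp (c * t + d)) t.
Proof.
apply (continuous_comp (fun t => c * t + d) clamp).
- apply (continuous_plus (V := R_NormedModule)); [| apply continuous_const].
  apply (continuous_mult (K := R_AbsRing)); [apply continuous_const | apply continuous_id].
- apply filterlim_locally; intros e; exists e; intros u hu.
  change (Rabs (clamp u - clamp (c * t + d)) < e).
  eapply Rle_lt_trans; [apply clamp_lip | exact hu].
Qed.

Lemma concat_motion_twist i t : (i < 4)%nat -> unit_interval t ->
  concat_motion inner_full_twists outer_full_twist i t
  = twist (clamp (2 * t + 0)) (clamp (2 * t + -1)) (base_point i).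
Proof.
intros hi [ht0 ht1]; rewrite twist_base_point by trivial.
unfold concat_motion; destruct (Rle_dec t (1 / 2)) as [h | h].
- rewrite (clamp_id (2 * t + 0)) by (unfold unit_interval; lra).
  rewrite (clamp_le (2 * t + -1)) by lra.
  rewrite Rplus_0_r, Rmult_0_r.
  destruct i as [| [| [| [| i]]]]; [..| lia]; simpl; rewrite ?cis_0; ring.
- rewrite (clamp_ge (2 * t + 0)) by lra.
  rewrite (clamp_id (2 * t + -1)) by (unfold unit_interval; lra).
  assert (h4 : cis (4 * PI * 1) = RtoC 1).
  { replace (4 * PI * 1) with (2 * PI + 2 * PI) by ring.
    rewrite cis_add, cis_2PI; ring. }
  replace (2 * t + -1) with (2 * t - 1) by ring.
  destruct i as [| [| [| [| i]]]]; [..| lia]; simpl; rewrite ?h4; ring.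
Qed.

Theorem theorem5p8 :
  exists b : braid_group (fiber curve (RtoC 1)),
    unique (is_local_braid_monodromy curve 4) b
    /\ unique (induces (fiber curve (RtoC 1)) 4
                 (concat_motion inner_full_twists outer_full_twist)) b.
Proof.
assert (hfib : forall t y, curve (cis (2 * PI * t)) y <->
  exists i, (i < 4)%nat /\ twist t t (base_point i) = y).
{ intros t y; rewrite curve_fiber.
  split; intros (i & hi & <-); exists i; split; trivial;
    rewrite twist_base_point by trivial; f_equal; destruct (Nat.ltb i 2);
    f_equal; ring. }
assert (hmono : induces K 4 (fun i t => twist t t (base_point i))
  (braid_class full_twists)).
{ apply (twist_motion_induces (fun t => t) (fun t => t)); trivial;
    apply continuous_id. }
assert (hconcat : induces K 4
  (concat_motion inner_full_twists outer_full_twist) (braid_class full_twists)).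
{ apply (twist_motion_induces (fun t => clamp (2 * t + 0))
    (fun t => clamp (2 * t + -1))).
  - intros t; apply continuous_clamp_affine.
  - intros t; apply continuous_clamp_affine.
  - apply clamp_le; lra.
  - apply clamp_le; lra.
  - apply clamp_ge; lra.
  - apply clamp_ge; lra.
  - apply concat_motion_twist. }
exists (braid_class full_twists); split; split.
- exists (fun i t => twist t t (base_point i)); split; [| exact hmono].
  intros t _ y; apply hfib.
- intros b' (m & hm & hb').
  refine (same_points_same_braid _ _ _ _ m _ _ _ hmono hb').
  intros t ht y; rewrite <- hfib; now apply hm.
- exact hconcat.
- intros b' hb'.
  refine (same_points_same_braid _ _ _ _ _ _ _ _ hconcat hb').
  reflexivity.
Qed.
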